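(* (Extension Theorem) Let $M$ be a Pincherle realiser and let $e_0$ be a Kleene index for the partially computable functional $\Phi$ given by $\Phi(F)=\{e_0\}(F,\mu)$ (with $F$ of type $2$). Then, uniformly in $M$, $\Phi$ has a total extension (depending on $M$) that is primitive recursive in $M$ and $\mu$.
   Context: $C=2^{\mathbb N}$; for $f\in C$, $\overline{f}n=\langle f(0),\dots,f(n-1)\rangle$ and $[\sigma]$ is the set of $g\in C$ extending $\sigma$. For $F,G:C\to\mathbb N$, $\mathsf{LOC}(F,G)$ means $(\forall f,g\in C)\big(g\in[\overline{f}G(f)]\to F(g)\le G(f)\big)$. A Pincherle realiser is a functional $M$ assigning natural numbers to functionals $G:C\to\mathbb N$ such that $(\forall F,G)\big(\mathsf{LOC}(F,G)\to(\forall g\in C)(F(g)\le M(G))\big)$. $\mu$ is Feferman's functional: $\mu(f)$ is the least $n$ with $f(n)=0$ if such $n$ exists, and $0$ otherwise. $\{e\}(\cdot)$ denotes Kleene computation with index $e$ in the sense of the schemes S1–S9; primitive recursion is in the sense of higher-type (Kleene) computability. *)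

(* Defs.v *)
From Stdlib Require Import Arith List Cantor ClassicalEpsilon.
Import ListNotations.

Fixpoint Tp (n : nat) : Type :=
  match n with
  | 0 => nat
  | S k => Tp k -> nat
  end.

Definition obj := {n : nat & Tp n}.
Definition ob (n : nat) (x : Tp n) : obj := existT Tp n x.

(* Cantor space C = 2^N, viewed inside Baire space N^N (type 1) *)
Definition inC (f : nat -> nat) : Prop := forall n, f n <= 1.

Definition extends_seg (g f : nat -> nat) (n : nat) : Prop :=
  forall i, i < n -> g i = f i.

(* LOC(F,G) for F, G : C -> N (type-2 objects restricted to C) *)
Definition LOC (F G : Tp 2) : Prop :=
  forall f g : nat -> nat, inC f -> inC g ->
    extends_seg g f (G f) -> F g <= G f.

Definition Pincherle_realiser (M : Tp 3) : Prop :=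
  forall F G : Tp 2, LOC F G -> forall g : nat -> nat, inC g -> F g <= M G.

Definition mu : Tp 2 := fun f : nat -> nat =>
  match excluded_middle_informative
          (exists n, f n = 0 /\ forall m, m < n -> f m <> 0) with
  | left H => proj1_sig (constructive_indefinite_description _ H)
  | right _ => 0
  end.

(* Kleene schemes; indices are natural numbers decoded via Cantor pairing *)
Inductive instr : Type :=
  | I_succ                      (* S1: {e}(x, Phi) = x+1 *)
  | I_const (q : nat)           (* S2: {e}(Phi) = q *)
  | I_proj                      (* S3: {e}(x, Phi) = x *)
  | I_comp (e1 e2 : nat)        (* S4: {e}(Phi) = {e1}({e2}(Phi), Phi) *)
  | I_prec (e1 e2 : nat)
  | I_perm (i e1 : nat)         (* S6: swap arguments i and i+1 *)
  | I_app                       (* S7: {e}(f, x, Phi) = f(x) *)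
  | I_high (e1 : nat)           (* S8: {e}(F,Phi) = F(fun xi => {e1}(xi,F,Phi)) *)
  | I_enum.                     (* S9: {e}(a, Phi) = {a}(Phi) *)

Definition decode (e : nat) : instr :=
  let (t, r) := of_nat e in
  match t with
  | 0 => I_succ
  | 1 => I_const r
  | 2 => I_proj
  | 3 => let (a, b) := of_nat r in I_comp a b
  | 4 => let (a, b) := of_nat r in I_prec a b
  | 5 => let (a, b) := of_nat r in I_perm a b
  | 6 => I_app
  | 7 => I_high r
  | 8 => I_enum
  | _ => I_succ
  end.

Definition swap_at (i : nat) (l : list obj) : list obj :=
  firstn i l ++
  match skipn i l with
  | a :: b :: rest => b :: a :: rest
  | rest => rest
  end.

(* Comp e args n  :  {e}(args) converges with value n *)
Inductive Comp : nat -> list obj -> nat -> Prop :=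
  | C_succ e x args : decode e = I_succ ->
      Comp e (ob 0 x :: args) (S x)
  | C_const e q args : decode e = I_const q -> Comp e args q
  | C_proj e x args : decode e = I_proj -> Comp e (ob 0 x :: args) x
  | C_comp e e1 e2 args m n : decode e = I_comp e1 e2 ->
      Comp e2 args m -> Comp e1 (ob 0 m :: args) n -> Comp e args n
  | C_prec0 e e1 e2 args n : decode e = I_prec e1 e2 ->
      Comp e1 args n -> Comp e (ob 0 0 :: args) n
  | C_precS e e1 e2 k args m n : decode e = I_prec e1 e2 ->
      Comp e (ob 0 k :: args) m ->
      Comp e2 (ob 0 m :: ob 0 k :: args) n ->
      Comp e (ob 0 (S k) :: args) n
  | C_perm e i e1 args n : decode e = I_perm i e1 ->
      S i < length args ->
      Comp e1 (swap_at i args) n -> Comp e args n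
  | C_app e (f : Tp 1) x args : decode e = I_app ->
      Comp e (ob 1 f :: ob 0 x :: args) (f x)
  | C_high e e1 k (F : Tp (S (S k))) (g : Tp (S k)) args : decode e = I_high e1 ->
      (forall xi : Tp k, Comp e1 (ob k xi :: ob (S (S k)) F :: args) (g xi)) ->
      Comp e (ob (S (S k)) F :: args) (F g)
  | C_enum e a args n : decode e = I_enum ->
      Comp a args n -> Comp e (ob 0 a :: args) n.

Inductive prim : nat -> Prop :=
  | P_succ e : decode e = I_succ -> prim e
  | P_const e q : decode e = I_const q -> prim e
  | P_proj e : decode e = I_proj -> prim e
  | P_comp e e1 e2 : decode e = I_comp e1 e2 -> prim e1 -> prim e2 -> prim e
  | P_prec e e1 e2 : decode e = I_prec e1 e2 -> prim e1 -> prim e2 -> prim e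
  | P_perm e i e1 : decode e = I_perm i e1 -> prim e1 -> prim e
  | P_app e : decode e = I_app -> prim e
  | P_high e e1 : decode e = I_high e1 -> prim e1 -> prim e.

(* Main.v *)
Require Import Defs.
From Stdlib Require Import Arith List Cantor Lia Eqdep_dec.
From Stdlib Require Import ClassicalEpsilon FunctionalExtensionality.
Import ListNotations.

(** An element [f] of Cantor space is read as a guess at the graph of the map that sends a
coded subcomputation of [{e0}(F, mu)] to its value.  Whether the guess is consistent with
the schemes along all subcomputations that it predicts is arithmetical in [F] and [f].
Suppose that [{e0}(F, mu)] converges to [n].  A consistent guess yields [n]; from an
inconsistent one, descending into the leftmost inconsistent subcomputation, [mu] finds a
place where it differs from the true graph.

Let [G_i f] exceed such a place if [f] is inconsistent, and otherwise be the largest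
[j <= i] that codes a pair with first component the value guessed by [f].  No inconsistent
guess covers the true graph, so [M G_i] is unbounded in [i]; on the other hand
[G_(i+1) = G_i], hence [M G_(i+1) = M G_i], unless [i+1] codes a pair with first component
[n].  Thus [n] can be read off from the least [i] with [M G_i <> M G_(i+1)]. *)

(** * Indices and permutations of arguments *)

Definition index_of (i : instr) : nat :=
  match i with
  | I_succ => to_nat (0, 0)
  | I_const q => to_nat (1, q)
  | I_proj => to_nat (2, 0)
  | I_comp a b => to_nat (3, to_nat (a, b))
  | I_prec a b => to_nat (4, to_nat (a, b))
  | I_perm a b => to_nat (5, to_nat (a, b))
  | I_app => to_nat (6, 0)
  | I_high a => to_nat (7, a)
  | I_enum => to_nat (8, 0)
  end.

Arguments index_of : simpl never.
Arguments to_nat : simpl never.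
Arguments of_nat : simpl never.

Lemma decode_index_of (i : instr) : decode (index_of i) = i.
Proof.
  destruct i; unfold decode, index_of; rewrite cancel_of_to; try reflexivity;
    rewrite cancel_of_to; reflexivity.
Qed.

Lemma swap_at_app (P : list obj) (x y : obj) (R : list obj) :
  swap_at (length P) (P ++ x :: y :: R) = P ++ y :: x :: R.
Proof.
  unfold swap_at.
  rewrite firstn_app, skipn_app, Nat.sub_diag, firstn_all, skipn_all.
  simpl. now rewrite app_nil_r.
Qed.

Lemma prim_swap (p e : nat) : prim e ->
  exists e', prim e' /\ forall P x y R n, length P = p ->
    Comp e (P ++ y :: x :: R) n -> Comp e' (P ++ x :: y :: R) n.
Proof.
  intros He. exists (index_of (I_perm p e)). split.
  - now eapply P_perm; [apply decode_index_of|].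
  - intros P x y R n <- H. eapply C_perm; [apply decode_index_of| |].
    + rewrite length_app. simpl. lia.
    + now rewrite swap_at_app.
Qed.

(** S6 only exchanges neighbours, so [x] crosses [A] by [a] successive swaps. The index depends on
    the lengths [p] and [a] alone, which makes it uniform in the objects themselves. *)
Lemma prim_move_front (a p e : nat) : prim e ->
  exists e', prim e' /\ forall P A x R n, length P = p -> length A = a ->
    Comp e (P ++ x :: A ++ R) n -> Comp e' (P ++ A ++ x :: R) n.
Proof.
  revert p e. induction a as [|a IH]; intros p e He.
  - exists e. split; [exact He|]. intros P [|? A] x R n _ HA H; [exact H|discriminate].
  - destruct (prim_swap p e He) as (e1 & He1 & H1).
    destruct (IH (S p) e1 He1) as (e2 & He2 & H2).
    exists e2. split; [exact He2|]. intros P [|y A] x R n HP HA H; [discriminate|].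
    injection HA as HA. specialize (H2 (P ++ [y]) A x R n).
    rewrite length_app, <- !app_assoc in H2. simpl in H2 |- *.
    apply H2; [lia|exact HA|]. now apply H1.
Qed.

Lemma prim_move_back (a p e : nat) : prim e ->
  exists e', prim e' /\ forall P A x R n, length P = p -> length A = a ->
    Comp e (P ++ A ++ x :: R) n -> Comp e' (P ++ x :: A ++ R) n.
Proof.
  revert p e. induction a as [|a IH]; intros p e He.
  - exists e. split; [exact He|]. intros P [|? A] x R n _ HA H; [exact H|discriminate].
  - destruct (IH (S p) e He) as (e1 & He1 & H1).
    destruct (prim_swap p e1 He1) as (e2 & He2 & H2).
    exists e2. split; [exact He2|]. intros P [|y A] x R n HP HA H; [discriminate|].
    injection HA as HA. simpl. apply H2; [exact HP|].
    specialize (H1 (P ++ [y]) A x R n).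
    rewrite length_app, <- !app_assoc in H1. simpl in H1.
    apply H1; [lia|exact HA|exact H].
Qed.

(** * Functionals definable by primitive recursive indices *)

Definition numerals (l : list nat) : list obj := map (ob 0) l.
Definition functions (fs : list (Tp 1)) : list obj := map (ob 1) fs.

(* The trailing arguments [R] are ignored; since there is no scheme that drops an
   argument, weakening is implemented by moving the unused argument there. *)
Definition arguments (F : Tp 2) (M : Tp 3) (fs : list (Tp 1)) (l : list nat)
    (R : list obj) : list obj :=
  numerals l ++ functions fs ++ ob 2 F :: ob 3 M :: ob 2 mu :: R.

Definition functional : Type := Tp 2 -> Tp 3 -> list (Tp 1) -> list nat -> nat.

(** The index is fixed before [F] and [M] are given; the uniformity in [M] of the final theorem
    comes from here. *)
Definition Definable (j k : nat) (phi : functional) : Prop :=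
  exists e, prim e /\ forall F M fs l R, length fs = j -> length l = k ->
    Comp e (arguments F M fs l R) (phi F M fs l).

Lemma length_numerals (l : list nat) : length (numerals l) = length l.
Proof. apply length_map. Qed.

Lemma length_functions (fs : list (Tp 1)) : length (functions fs) = length fs.
Proof. apply length_map. Qed.

Lemma def_ext (j k : nat) (phi psi : functional) :
  (forall F M fs l, phi F M fs l = psi F M fs l) ->
  Definable j k phi -> Definable j k psi.
Proof.
  intros E (e & He & H). exists e. split; [exact He|].
  intros. rewrite <- E. now apply H.
Qed.

Lemma def_const (j k q : nat) : Definable j k (fun _ _ _ _ => q).
Proof.
  exists (index_of (I_const q)). split.
  - eapply P_const, decode_index_of.
  - intros. apply C_const, decode_index_of.
Qed.

(** With iterated [tl], each concrete [i] gives a term convertible with the nested [hd] and [tl]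
    that the binding lemmas produce. *)
Lemma def_var (i j k : nat) : i < k ->
  Definable j k (fun _ _ _ l => hd 0 (Nat.iter i (@tl nat) l)).
Proof.
  intros Hi.
  destruct (prim_move_front i 0 (index_of I_proj)) as (e & He & H).
  { eapply P_proj, decode_index_of. }
  exists e. split; [exact He|]. intros F M fs l R _ Hl.
  assert (E : exists A B, length A = i /\
             l = A ++ hd 0 (Nat.iter i (@tl nat) l) :: B).
  { clear - Hi Hl. subst k. revert l Hi. induction i as [|i IH]; intros [|x l] Hi;
      simpl in Hi; try lia.
    - now exists [], l.
    - destruct (IH l) as (A & B & HA & HB); [lia|].
      exists (x :: A), B. rewrite Nat.iter_succ_r. simpl. split; [now rewrite HA|].
      now rewrite <- HB. }
  destruct E as (A & B & HA & E). unfold arguments. rewrite E at 1.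
  unfold numerals. rewrite map_app, <- app_assoc. simpl.
  apply (H []); [reflexivity|now rewrite length_map|].
  apply C_proj, decode_index_of.
Qed.

(** S4 puts the intermediate value in front of the arguments. From here on a bound number is the
    head of [l] and the older variables form its tail. *)
Lemma def_let (j k : nat) (a : functional)
    (b : Tp 2 -> Tp 3 -> list (Tp 1) -> nat -> list nat -> nat) :
  Definable j k a ->
  Definable j (S k) (fun F M fs l => b F M fs (hd 0 l) (tl l)) ->
  Definable j k (fun F M fs l => b F M fs (a F M fs l) l).
Proof.
  intros (e1 & He1 & H1) (e2 & He2 & H2).
  exists (index_of (I_comp e2 e1)). split.
  - eapply P_comp; [apply decode_index_of| |]; assumption.
  - intros F M fs l R Hj Hk. eapply C_comp; [apply decode_index_of|now apply H1|].
    apply (H2 F M fs (_ :: l) R); [exact Hj|simpl; congruence].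
Qed.

Lemma def_succ (j k : nat) (a : functional) :
  Definable j k a -> Definable j k (fun F M fs l => S (a F M fs l)).
Proof.
  intros H. apply (def_let j k a (fun _ _ _ x _ => S x) H).
  exists (index_of I_succ). split.
  - eapply P_succ, decode_index_of.
  - intros F M fs [|x l] R _ Hl; [discriminate|]. apply C_succ, decode_index_of.
Qed.

Lemma def_weaken (j k : nat) (a : functional) :
  Definable j k a -> Definable j (S k) (fun F M fs l => a F M fs (tl l)).
Proof.
  intros (e & He & H).
  (* In front of [R] stand [k] numerals, [j] functions and the three objects [F], [M], [mu]. *)
  destruct (prim_move_back (k + j + 3) 0 e He) as (e' & He' & H').
  exists e'. split; [exact He'|]. intros F M fs [|x l] R Hj Hk; [discriminate|].
  injection Hk as Hk. unfold arguments. simpl.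
  replace (numerals l ++ functions fs ++ ob 2 F :: ob 3 M :: ob 2 mu :: R)
    with ((numerals l ++ functions fs ++ [ob 2 F; ob 3 M; ob 2 mu]) ++ R)
    by (rewrite <- !app_assoc; reflexivity).
  apply (H' []); [reflexivity| |].
  - rewrite !length_app, length_numerals, length_functions, Hj, Hk. simpl. lia.
  - specialize (H F M fs l (ob 0 x :: R) Hj Hk). unfold arguments in H.
    simpl. rewrite <- !app_assoc. exact H.
Qed.

(** S5 passes the previous value first and the counter second, hence the order of the two heads in
    the hypothesis on [s]. *)
Lemma def_rec (j k : nat) (n z : functional)
    (s : Tp 2 -> Tp 3 -> list (Tp 1) -> nat -> nat -> list nat -> nat) :
  Definable j k n -> Definable j k z ->
  Definable j (S (S k))
    (fun F M fs l => s F M fs (hd 0 (tl l)) (hd 0 l) (tl (tl l))) ->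
  Definable j k (fun F M fs l =>
    nat_rec (fun _ => nat) (z F M fs l) (fun i acc => s F M fs i acc l) (n F M fs l)).
Proof.
  intros Hn (e1 & He1 & H1) (e2 & He2 & H2).
  apply (def_let j k n (fun F M fs x l =>
    nat_rec (fun _ => nat) (z F M fs l) (fun i acc => s F M fs i acc l) x) Hn).
  exists (index_of (I_prec e1 e2)). split.
  - eapply P_prec; [apply decode_index_of| |]; assumption.
  - intros F M fs [|x l] R Hj Hk; [discriminate|]. injection Hk as Hk. simpl.
    induction x as [|x IH].
    + eapply C_prec0; [apply decode_index_of|now apply H1].
    + eapply C_precS; [apply decode_index_of|exact IH|].
      apply (H2 F M fs (_ :: x :: l) R); [exact Hj|simpl; congruence].
Qed.

Lemma def_apply (j k : nat) (a : functional) :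
  Definable (S j) k a ->
  Definable (S j) k (fun F M fs l => hd (fun _ => 0) fs (a F M fs l)).
Proof.
  intros H. apply (def_let _ k a (fun _ _ fs x _ => hd (fun _ => 0) fs x) H).
  destruct (prim_move_front (S k) 0 (index_of I_app)) as (e & He & H').
  { eapply P_app, decode_index_of. }
  exists e. split; [exact He|].
  intros F M [|f fs] [|x l] R Hj Hk; try discriminate.
  unfold arguments.
  apply (H' [] (numerals (x :: l)) (ob 1 f));
    [reflexivity|now rewrite length_numerals|].
  simpl. apply (C_app _ f), decode_index_of.
Qed.

(** S8 wants [Psi] first and adds [xi] in front of it. The index fetches [Psi], applies S8, returns
    [Psi] behind [C] and inserts [xi] behind [B], where a new variable is expected. *)
Lemma prim_high (t p q r e : nat) : prim e ->
  exists e', prim e' /\ forall (Psi : Tp (S (S t))) (g : Tp (S t)) A B C R,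
    length A = p -> length B = q -> length C = r ->
    (forall xi, Comp e (A ++ B ++ ob t xi :: C ++ ob (S (S t)) Psi :: R) (g xi)) ->
    Comp e' (A ++ B ++ C ++ ob (S (S t)) Psi :: R) (Psi g).
Proof.
  intros He.
  destruct (prim_move_back (p + q) 0 e He) as (e1 & He1 & H1).
  destruct (prim_move_back (p + q + r) 1 e1 He1) as (e2 & He2 & H2).
  destruct (prim_move_front (p + q + r) 0 (index_of (I_high e2))) as (e3 & He3 & H3).
  { eapply P_high; [apply decode_index_of|exact He2]. }
  exists e3. split; [exact He3|]. intros Psi g A B C R HA HB HC H.
  replace (A ++ B ++ C ++ ob (S (S t)) Psi :: R)
    with ((A ++ B ++ C) ++ ob (S (S t)) Psi :: R) by (rewrite <- !app_assoc; reflexivity).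
  apply (H3 []); [reflexivity|rewrite !length_app; lia|].
  simpl. apply C_high with (e1 := e2); [apply decode_index_of|]. intros xi.
  apply (H2 [ob t xi]); [reflexivity|rewrite !length_app; lia|].
  simpl. rewrite <- !app_assoc.
  replace (A ++ B ++ C ++ ob (S (S t)) Psi :: R)
    with ((A ++ B) ++ C ++ ob (S (S t)) Psi :: R) by (rewrite <- !app_assoc; reflexivity).
  apply (H1 []); [reflexivity|rewrite !length_app; lia|].
  simpl. rewrite <- !app_assoc. apply H.
Qed.

Lemma def_F (j k : nat) (b : Tp 2 -> Tp 3 -> list (Tp 1) -> nat -> list nat -> nat) :
  Definable j (S k) (fun F M fs l => b F M fs (hd 0 l) (tl l)) ->
  Definable j k (fun F M fs l => F (fun x => b F M fs x l)).
Proof.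
  intros (e & He & H). destruct (prim_high 0 0 0 (k + j) e He) as (e' & He' & H').
  exists e'. split; [exact He'|]. intros F M fs l R Hj Hk. unfold arguments.
  rewrite app_assoc. apply (H' F (fun x => b F M fs x l) [] []); try reflexivity.
  - rewrite length_app, length_numerals, length_functions, Hj, Hk. lia.
  - intros x. specialize (H F M fs (x :: l) R Hj). simpl in H |- *.
    rewrite <- app_assoc. apply H. congruence.
Qed.

Lemma def_mu (j k : nat) (b : Tp 2 -> Tp 3 -> list (Tp 1) -> nat -> list nat -> nat) :
  Definable j (S k) (fun F M fs l => b F M fs (hd 0 l) (tl l)) ->
  Definable j k (fun F M fs l => mu (fun x => b F M fs x l)).
Proof.
  intros (e & He & H). destruct (prim_high 0 0 0 (k + j + 2) e He) as (e' & He' & H').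
  exists e'. split; [exact He'|]. intros F M fs l R Hj Hk. unfold arguments.
  replace (numerals l ++ functions fs ++ ob 2 F :: ob 3 M :: ob 2 mu :: R)
    with ((numerals l ++ functions fs ++ [ob 2 F; ob 3 M]) ++ ob 2 mu :: R)
    by (rewrite <- !app_assoc; reflexivity).
  apply (H' mu (fun x => b F M fs x l) [] []); try reflexivity.
  - rewrite !length_app, length_numerals, length_functions, Hj, Hk. simpl. lia.
  - intros x. specialize (H F M fs (x :: l) R Hj). simpl in H |- *.
    rewrite <- !app_assoc. apply H. congruence.
Qed.

Lemma def_M (j k : nat)
    (b : Tp 2 -> Tp 3 -> Tp 1 -> list (Tp 1) -> list nat -> nat) :
  Definable (S j) k (fun F M fs l => b F M (hd (fun _ => 0) fs) (tl fs) l) ->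
  Definable j k (fun F M fs l => M (fun f => b F M f fs l)).
Proof.
  (* The block [B] consists of the numerals, so the bound function lands at the head of [fs]. *)
  intros (e & He & H). destruct (prim_high 1 0 k (j + 1) e He) as (e' & He' & H').
  exists e'. split; [exact He'|]. intros F M fs l R Hj Hk. unfold arguments.
  replace (functions fs ++ ob 2 F :: ob 3 M :: ob 2 mu :: R)
    with ((functions fs ++ [ob 2 F]) ++ ob 3 M :: ob 2 mu :: R)
    by (rewrite <- !app_assoc; reflexivity).
  apply (H' M (fun f => b F M f fs l) []); try reflexivity.
  - now rewrite length_numerals.
  - rewrite length_app, length_functions, Hj. simpl. lia.
  - intros f. specialize (H F M (f :: fs) l R). simpl in H |- *.
    rewrite <- !app_assoc. apply H; [now f_equal|exact Hk].
Qed.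

(** * Arithmetical predicates and search with [mu] *)

Definition ite (P : Prop) (a b : nat) : nat :=
  if excluded_middle_informative P then a else b.

Lemma ite_true (P : Prop) (a b : nat) : P -> ite P a b = a.
Proof. unfold ite. now destruct (excluded_middle_informative P). Qed.

Lemma ite_false (P : Prop) (a b : nat) : ~ P -> ite P a b = b.
Proof. unfold ite. now destruct (excluded_middle_informative P). Qed.

(* Truth is coded by [0], the value that [mu] searches for. *)
Definition chi (P : Prop) : nat := ite P 0 1.

Lemma chi_iff (P Q : Prop) : (P <-> Q) -> chi P = chi Q.
Proof.
  unfold chi, ite. intros E.
  destruct (excluded_middle_informative P), (excluded_middle_informative Q); tauto.
Qed.

Lemma chi_eq0 (P : Prop) : chi P = 0 <-> P.
Proof.
  unfold chi, ite. destruct (excluded_middle_informative P); split; congruence || tauto.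
Qed.

Definition least (P : nat -> Prop) : nat := mu (fun x => chi (P x)).

Lemma ex_minimal (P : nat -> Prop) :
  (exists n, P n) -> exists n, P n /\ forall m, m < n -> ~ P m.
Proof.
  intros [n Hn]. induction n as [n IH] using lt_wf_ind.
  destruct (classic (exists m, m < n /\ P m)) as [(m & Hm & Pm)|H].
  - now apply (IH m).
  - exists n. split; [exact Hn|]. intros m Hm Pm. apply H. now exists m.
Qed.

Lemma least_spec (P : nat -> Prop) :
  (exists n, P n) -> P (least P) /\ forall m, m < least P -> ~ P m.
Proof.
  intros H. unfold least, mu.
  destruct (excluded_middle_informative _) as [E|E].
  - destruct (constructive_indefinite_description _ E) as [n [Hn Hm]]. simpl.
    split; [now apply chi_eq0|]. intros m Hlt Pm. apply (Hm m Hlt). now apply chi_eq0.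
  - destruct E. destruct (ex_minimal P H) as (n & Hn & Hm). exists n.
    split; [now apply chi_eq0|]. intros m Hlt Pm. apply (Hm m Hlt). now apply chi_eq0.
Qed.

Lemma least_eq (P : nat -> Prop) (n : nat) :
  P n -> (forall m, m < n -> ~ P m) -> least P = n.
Proof.
  intros Hn Hm. destruct (least_spec P) as [H1 H2]; [now exists n|].
  destruct (lt_eq_lt_dec (least P) n) as [[H|H]|H]; [|exact H|].
  - now destruct (Hm _ H).
  - now destruct (H2 _ H).
Qed.

Ltac def_lookup :=
  first
  [ apply (def_var 0); lia | apply (def_var 1); lia
  | apply (def_var 2); lia | apply (def_var 3); lia
  | match goal with H : Definable _ _ _ |- _ =>
      first [ exact H | exact (def_weaken _ _ _ H)
            | exact (def_weaken _ _ _ (def_weaken _ _ _ H))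
            | exact (def_weaken _ _ _ (def_weaken _ _ _ (def_weaken _ _ _ H))) ]
    end ].

Lemma def_ite (j k : nat) (P : Tp 2 -> Tp 3 -> list (Tp 1) -> list nat -> Prop)
    (a b : functional) :
  Definable j k (fun F M fs l => chi (P F M fs l)) ->
  Definable j k a -> Definable j k b ->
  Definable j k (fun F M fs l => ite (P F M fs l) (a F M fs l) (b F M fs l)).
Proof.
  intros HP Ha Hb.
  (* Recursion on the truth value: [0] gives [a], while the single step taken from [1] discards [a]
     and gives [b]. *)
  eapply def_ext; [|apply (def_rec j k _ a (fun F M fs _ _ l => b F M fs l) HP Ha)].
  - intros F M fs l. cbv beta. unfold chi, ite.
    now destruct (excluded_middle_informative (P F M fs l)).
  - def_lookup.
Qed.

Lemma def_add (j k : nat) (a b : functional) :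
  Definable j k a -> Definable j k b ->
  Definable j k (fun F M fs l => a F M fs l + b F M fs l).
Proof.
  intros Ha Hb.
  eapply def_ext; [|apply (def_rec j k a b (fun _ _ _ _ x _ => S x) Ha Hb)].
  - intros F M fs l. cbv beta. induction (a F M fs l); simpl; congruence.
  - apply def_succ. def_lookup.
Qed.

Lemma def_pred (j k : nat) (a : functional) :
  Definable j k a -> Definable j k (fun F M fs l => pred (a F M fs l)).
Proof.
  intros Ha.
  eapply def_ext;
    [|apply (def_rec j k a (fun _ _ _ _ => 0) (fun _ _ _ i _ _ => i) Ha (def_const _ _ _))].
  - intros F M fs l. cbv beta. now destruct (a F M fs l).
  - def_lookup.
Qed.

Lemma def_sub (j k : nat) (a b : functional) :
  Definable j k a -> Definable j k b ->
  Definable j k (fun F M fs l => a F M fs l - b F M fs l).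
Proof.
  intros Ha Hb.
  eapply def_ext; [|apply (def_rec j k b a (fun _ _ _ _ x _ => pred x) Hb Ha)].
  - intros F M fs l. cbv beta. induction (b F M fs l); simpl; lia.
  - apply def_pred. def_lookup.
Qed.

Lemma def_iter (j k : nat) (n z : functional)
    (s : Tp 2 -> Tp 3 -> list (Tp 1) -> nat -> list nat -> nat) :
  Definable j k n -> Definable j k z ->
  Definable j (S (S k)) (fun F M fs l => s F M fs (hd 0 l) (tl (tl l))) ->
  Definable j k (fun F M fs l =>
    Nat.iter (n F M fs l) (fun acc => s F M fs acc l) (z F M fs l)).
Proof.
  intros Hn Hz Hs.
  eapply def_ext; [|apply (def_rec j k n z (fun F M fs _ acc l => s F M fs acc l) Hn Hz Hs)].
  intros F M fs l. cbv beta. induction (n F M fs l); simpl; congruence.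
Qed.

Lemma def_chi_not (j k : nat) (P : Tp 2 -> Tp 3 -> list (Tp 1) -> list nat -> Prop) :
  Definable j k (fun F M fs l => chi (P F M fs l)) ->
  Definable j k (fun F M fs l => chi (~ P F M fs l)).
Proof.
  intros HP.
  eapply def_ext;
    [|apply (def_ite j k P (fun _ _ _ _ => 1) (fun _ _ _ _ => 0) HP); apply def_const].
  intros F M fs l. cbv beta. unfold chi, ite.
  destruct (excluded_middle_informative (P F M fs l)),
    (excluded_middle_informative (~ P F M fs l)); tauto.
Qed.

Lemma def_chi_or (j k : nat) (P Q : Tp 2 -> Tp 3 -> list (Tp 1) -> list nat -> Prop) :
  Definable j k (fun F M fs l => chi (P F M fs l)) ->
  Definable j k (fun F M fs l => chi (Q F M fs l)) ->
  Definable j k (fun F M fs l => chi (P F M fs l \/ Q F M fs l)).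
Proof.
  intros HP HQ.
  eapply def_ext; [|apply (def_ite j k P (fun _ _ _ _ => 0) _ HP (def_const _ _ _) HQ)].
  intros F M fs l. cbv beta. unfold chi, ite.
  destruct (excluded_middle_informative (P F M fs l)),
    (excluded_middle_informative (Q F M fs l)),
    (excluded_middle_informative (P F M fs l \/ Q F M fs l)); tauto.
Qed.

Lemma def_chi_eq (j k : nat) (a b : functional) :
  Definable j k a -> Definable j k b ->
  Definable j k (fun F M fs l => chi (a F M fs l = b F M fs l)).
Proof.
  intros Ha Hb.
  eapply def_ext; [|apply (def_rec j k
    (fun F M fs l => (a F M fs l - b F M fs l) + (b F M fs l - a F M fs l))
    (fun _ _ _ _ => 0) (fun _ _ _ _ _ _ => 1));
    [apply def_add; apply def_sub; assumption|apply def_const|apply def_const]].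
  intros F M fs l. cbv beta. unfold chi, ite.
  destruct (excluded_middle_informative _) as [E|E].
  - now rewrite E, Nat.sub_diag.
  - destruct (_ + _) eqn:E'; [lia|reflexivity].
Qed.

(** It suffices to test [P] at the number found by [mu]: it is a witness if there is one, and the
    default value fails [P] otherwise. *)
Lemma def_chi_ex (j k : nat)
    (P : Tp 2 -> Tp 3 -> list (Tp 1) -> nat -> list nat -> Prop) :
  Definable j (S k) (fun F M fs l => chi (P F M fs (hd 0 l) (tl l))) ->
  Definable j k (fun F M fs l => chi (exists x, P F M fs x l)).
Proof.
  intros HP.
  apply (def_ext j k (fun F M fs l => chi (P F M fs (least (fun x => P F M fs x l)) l))).
  - intros F M fs l. apply chi_iff. split; [eauto|]. intros H.
    now apply least_spec.
  - apply (def_let j k _ (fun F M fs x l => chi (P F M fs x l))); [|exact HP].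
    exact (def_mu j k (fun F M fs x l => chi (P F M fs x l)) HP).
Qed.

Lemma def_chi_all (j k : nat)
    (P : Tp 2 -> Tp 3 -> list (Tp 1) -> nat -> list nat -> Prop) :
  Definable j (S k) (fun F M fs l => chi (P F M fs (hd 0 l) (tl l))) ->
  Definable j k (fun F M fs l => chi (forall x, P F M fs x l)).
Proof.
  intros HP.
  apply (def_ext j k (fun F M fs l => chi (~ exists x, ~ P F M fs x l))).
  - intros F M fs l. apply chi_iff. split.
    + intros H x. apply NNPP. intros Hx. apply H. now exists x.
    + intros H [x Hx]. now apply Hx.
  - apply def_chi_not.
    apply (def_chi_ex j k (fun F M fs x l => ~ P F M fs x l)).
    now apply def_chi_not.
Qed.

Lemma def_least (j k : nat)
    (P : Tp 2 -> Tp 3 -> list (Tp 1) -> nat -> list nat -> Prop) :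
  Definable j (S k) (fun F M fs l => chi (P F M fs (hd 0 l) (tl l))) ->
  Definable j k (fun F M fs l => least (fun x => P F M fs x l)).
Proof. apply (def_mu j k (fun F M fs x l => chi (P F M fs x l))). Qed.

Ltac def_base :=
  lazymatch goal with
  | |- Definable _ _ (fun _ _ _ _ => S _) => first [ apply def_const | apply def_succ ]
  | |- Definable _ _ (fun _ _ _ _ => pred _) => apply def_pred
  | |- Definable _ _ (fun _ _ _ _ => _ + _) => apply def_add
  | |- Definable _ _ (fun _ _ _ _ => _ - _) => apply def_sub
  | |- Definable _ _ (fun _ _ _ _ => ite _ _ _) => apply def_ite
  | |- Definable _ _ (fun _ _ _ _ => Nat.iter _ _ _) => apply def_iter
  | |- Definable _ _ (fun _ _ _ _ => nat_rec _ _ _ _) => apply def_rec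
  | |- Definable _ _ (fun _ _ _ _ => least _) => apply def_least
  | |- Definable _ _ (fun _ _ _ _ => chi (_ = _)) => apply def_chi_eq
  | |- Definable _ _ (fun _ _ _ _ => chi (~ _)) => apply def_chi_not
  | |- Definable _ _ (fun _ _ _ _ => chi (_ \/ _)) => apply def_chi_or
  | |- Definable _ _ (fun _ _ _ _ => chi (exists _, _)) => apply def_chi_ex
  | |- Definable _ _ (fun _ _ _ _ => chi (forall _, _)) => apply def_chi_all
  | |- Definable _ _ (fun _ _ _ _ => hd (fun _ => 0) _ _) => apply def_apply
  | |- Definable _ _ _ => first [ def_lookup | apply def_const ]
  end.

(** * Cantor pairing *)

Definition cpair (x y : nat) : nat := to_nat (x, y).
Definition left_of (n : nat) : nat := fst (of_nat n).
Definition right_of (n : nat) : nat := snd (of_nat n).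

Lemma left_of_pair (x y : nat) : left_of (cpair x y) = x.
Proof. unfold left_of, cpair. now rewrite cancel_of_to. Qed.

Lemma right_of_pair (x y : nat) : right_of (cpair x y) = y.
Proof. unfold right_of, cpair. now rewrite cancel_of_to. Qed.

Lemma pair_left_right (n : nat) : cpair (left_of n) (right_of n) = n.
Proof. unfold left_of, right_of, cpair. now rewrite <- surjective_pairing, cancel_to_of. Qed.

Lemma def_pair (j k : nat) (a b : functional) :
  Definable j k a -> Definable j k b ->
  Definable j k (fun F M fs l => cpair (a F M fs l) (b F M fs l)).
Proof.
  (* The code of [(x, y)] is [y] plus the sum of the numbers from [1] to [y + x]. *)
  intros Ha Hb. unfold cpair, to_nat. apply def_add; [exact Hb|].
  apply (def_rec j k _ (fun _ _ _ _ => 0) (fun _ _ _ i m _ => S i + m)).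
  - now apply def_add.
  - apply def_const.
  - apply def_add; [apply def_succ|]; def_lookup.
Qed.

Ltac def_coding :=
  lazymatch goal with
  | |- Definable _ _ (fun _ _ _ _ => cpair _ _) => apply def_pair
  | |- _ => def_base
  end.

(** Rather than following the recursion of [of_nat], [mu] searches for the component. *)
Lemma def_left_of (j k : nat) (a : functional) :
  Definable j k a -> Definable j k (fun F M fs l => left_of (a F M fs l)).
Proof.
  intros Ha.
  apply (def_ext j k (fun F M fs l => least (fun x => exists y, cpair x y = a F M fs l))).
  - intros F M fs l. apply least_eq.
    + exists (right_of (a F M fs l)). apply pair_left_right.
    + intros m Hm [y Hy]. rewrite <- Hy, left_of_pair in Hm. lia.
  - repeat (cbv beta; def_coding).
Qed.

Lemma def_right_of (j k : nat) (a : functional) :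
  Definable j k a -> Definable j k (fun F M fs l => right_of (a F M fs l)).
Proof.
  intros Ha.
  apply (def_ext j k (fun F M fs l => least (fun y => exists x, cpair x y = a F M fs l))).
  - intros F M fs l. apply least_eq.
    + exists (left_of (a F M fs l)). apply pair_left_right.
    + intros m Hm [y Hy]. rewrite <- Hy, right_of_pair in Hm. lia.
  - repeat (cbv beta; def_coding).
Qed.

Ltac def_lists :=
  lazymatch goal with
  | |- Definable _ _ (fun _ _ _ _ => left_of _) => apply def_left_of
  | |- Definable _ _ (fun _ _ _ _ => right_of _) => apply def_right_of
  | |- _ => def_coding
  end.

(** * Coded computations *)

(** [F] and [mu] have type 2, so S8 binds only numbers. All argument lists in a computation of
    [{e0}(F, mu)] therefore consist of [F], [mu] and numbers, and can be coded by numbers. *)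
Inductive item : Type := it_F | it_mu | it_num (x : nat).

(** Numbers are shifted by [2] to make room for [F] and [mu]; this explains the offsets in the
    definitions on configurations below. *)
Definition item_code (a : item) : nat :=
  match a with it_F => 0 | it_mu => 1 | it_num x => S (S x) end.

Definition item_obj (F : Tp 2) (a : item) : obj :=
  match a with it_F => ob 2 F | it_mu => ob 2 mu | it_num x => ob 0 x end.

Definition list_code (L : list item) : nat :=
  fold_right (fun a c => cpair (item_code a) c) 0 L.

Definition entry (p i : nat) : nat := left_of (Nat.iter i right_of p).

Lemma entry_0 (k p : nat) : entry (cpair k p) 0 = k.
Proof. apply left_of_pair. Qed.

Lemma entry_S (p i : nat) : entry p (S i) = entry (right_of p) i.
Proof. unfold entry. now rewrite Nat.iter_succ_r. Qed.

Lemma def_entry (j k : nat) (a b : functional) :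
  Definable j k a -> Definable j k b ->
  Definable j k (fun F M fs l => entry (a F M fs l) (b F M fs l)).
Proof.
  intros Ha Hb. apply def_left_of.
  apply (def_iter j k b a (fun _ _ _ x _ => right_of x)); repeat (cbv beta; def_lists).
Qed.

(* The tail [t] of [l] from position [i] has its first two entries exchanged; the
   first [i] entries of [l] are then put back in front, from right to left. *)
Definition swap_code (i l : nat) : nat :=
  let t := Nat.iter i right_of l in
  nat_rec (fun _ => nat)
    (cpair (left_of (right_of t)) (cpair (left_of t) (right_of (right_of t))))
    (fun j acc => cpair (entry l (i - S j)) acc) i.

Lemma def_swap_code (j k : nat) (a b : functional) :
  Definable j k a -> Definable j k b ->
  Definable j k (fun F M fs l => swap_code (a F M fs l) (b F M fs l)).
Proof.
  intros Ha Hb.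
  assert (Ht : Definable j k (fun F M fs l => Nat.iter (a F M fs l) right_of (b F M fs l))).
  { apply (def_iter j k a b (fun _ _ _ x _ => right_of x)); repeat (cbv beta; def_lists). }
  unfold swap_code. apply def_rec.
  - exact Ha.
  - repeat first [exact Ht | apply def_pair | apply def_left_of | apply def_right_of].
  - apply def_pair; [apply def_entry|]; repeat (cbv beta; def_lists).
Qed.

Lemma iter_right_list_code (A B : list item) :
  Nat.iter (length A) right_of (list_code (A ++ B)) = list_code B.
Proof.
  induction A as [|x A IH]; [reflexivity|].
  change (length (x :: A)) with (S (length A)).
  rewrite Nat.iter_succ_r. simpl. now rewrite right_of_pair.
Qed.

Lemma swap_code_list_code (A : list item) (x y : item) (B : list item) :
  swap_code (length A) (list_code (A ++ x :: y :: B)) = list_code (A ++ y :: x :: B).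
Proof.
  unfold swap_code. rewrite iter_right_list_code. simpl.
  rewrite !right_of_pair, !left_of_pair.
  assert (H : forall A2 A1, A = A1 ++ A2 ->
    nat_rec (fun _ => nat)
      (cpair (item_code y) (cpair (item_code x) (list_code B)))
      (fun j acc =>
        cpair (entry (list_code (A ++ x :: y :: B)) (length A - S j)) acc)
      (length A2) = list_code (A2 ++ y :: x :: B)).
  { induction A2 as [|z A2 IH]; intros A1 E; [reflexivity|].
    simpl. rewrite (IH (A1 ++ [z])) by now rewrite <- app_assoc.
    f_equal. unfold entry.
    replace (length A - S (length A2)) with (length A1)
      by (rewrite E, length_app; simpl; lia).
    rewrite E, <- app_assoc, iter_right_list_code. apply left_of_pair. }
  now apply (H A []).
Qed.

Definition config (e : nat) (L : list item) : nat := cpair e (list_code L).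

Definition tag (c : nat) : nat := left_of (left_of c).
Definition index (c : nat) : nat := left_of c.
Definition param (c : nat) : nat := right_of (left_of c).
Definition args (c : nat) : nat := right_of c.
Definition head (c : nat) : nat := left_of (args c).
Definition tail (c : nat) : nat := right_of (args c).

(** The excluded tags are those of S4, S5, S6, S8 and S9, the schemes with subcomputations. *)
Definition leaf (c : nat) : Prop :=
  ~ (tag c = 3 \/ tag c = 4 \/ tag c = 5 \/ tag c = 7 \/ tag c = 8).

(** For S3, [head c - 2] undoes the shift of [item_code]; for S1 the successor leaves
    [head c - 1]. *)
Definition leaf_value (c : nat) : nat :=
  ite (tag c = 1) (param c) (ite (tag c = 2) (head c - 2) (head c - 1)).

(* Every configuration that is not a leaf gets one child for every [x]; [w] stands
   for the value of child [0].  Only the subcomputations that occur in [Comp] matter,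
   so ill-typed configurations may be given arbitrary children. *)
Definition child (c x w : nat) : nat :=
  let a := left_of (param c) in
  let b := right_of (param c) in
  ite (tag c = 3)
    (ite (x = 0) (cpair b (args c)) (cpair a (cpair (S (S w)) (args c))))
  (ite (tag c = 4)
    (ite (head c = 2) (cpair a (tail c))
      (ite (x = 0) (cpair (index c) (cpair (head c - 1) (tail c)))
        (cpair b (cpair (S (S w)) (cpair (head c - 1) (tail c))))))
  (ite (tag c = 5) (cpair b (swap_code a (args c)))
  (ite (tag c = 7) (cpair (param c) (cpair (S (S x)) (args c)))
    (cpair (head c - 2) (tail c))))).

(** Outside S8 the value is that of child [1]: child [0] supplies the intermediate value of S4 and
    S5, and in the remaining cases all children coincide. Under S8 a head coded by [0] is [F]. *)
Definition combine (F : Tp 2) (c : nat) (g : nat -> nat) : nat :=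
  ite (tag c = 7) (ite (head c = 0) (F g) (mu g)) (g 1).

Lemma child_0 (c w w' : nat) : child c 0 w = child c 0 w'.
Proof. unfold child. now rewrite !(ite_true (0 = 0)). Qed.

(** In [conv_node] the value [g 0] also occurs in child [0], whose value it is. By [child_0] this is
    not circular. *)
Inductive Converges (F : Tp 2) : nat -> nat -> Prop :=
  | conv_leaf c : leaf c -> Converges F c (leaf_value c)
  | conv_node c (g : nat -> nat) : ~ leaf c ->
      (forall x, Converges F (child c x (g 0)) (g x)) ->
      Converges F c (combine F c g).

Lemma converges_functional (F : Tp 2) (c n m : nat) :
  Converges F c n -> Converges F c m -> n = m.
Proof.
  intros H. revert m. induction H as [c Hc|c g Hc Hg IH]; intros m H.
  - destruct H as [c _|c g' Hc' _]; [reflexivity|contradiction].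
  - destruct H as [c Hc'|c g' _ Hg']; [contradiction|].
    f_equal. apply functional_extensionality. intros x.
    assert (E : g 0 = g' 0).
    { apply IH. rewrite (child_0 c _ (g' 0)). apply Hg'. }
    apply IH. rewrite E. apply Hg'.
Qed.

(** [decode] also reads tags above [8] as [I_succ], so that case can only say which tags are
    excluded. *)
Lemma decode_tag (e : nat) (L : list item) :
  match decode e with
  | I_succ => leaf (config e L) /\ tag (config e L) <> 1 /\ tag (config e L) <> 2
  | I_const q => tag (config e L) = 1 /\ param (config e L) = q
  | I_proj => tag (config e L) = 2
  | I_comp a b => tag (config e L) = 3 /\ param (config e L) = cpair a b
  | I_prec a b => tag (config e L) = 4 /\ param (config e L) = cpair a b
  | I_perm a b => tag (config e L) = 5 /\ param (config e L) = cpair a b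
  | I_app => tag (config e L) = 6
  | I_high a => tag (config e L) = 7 /\ param (config e L) = a
  | I_enum => tag (config e L) = 8
  end.
Proof.
  unfold leaf, config, tag, param. rewrite left_of_pair.
  unfold decode, left_of, right_of, cpair.
  destruct (of_nat e) as [t r]. simpl.
  destruct t as [|[|[|[|[|[|[|[|[|t]]]]]]]]]; simpl; try lia.
  all: destruct (of_nat r) eqn:E; split; [reflexivity|].
  all: now rewrite <- E, cancel_to_of.
Qed.

(** Serves S4, S5, S6 and S9; all children after child [0] are given the same value. *)
Lemma converges_seq (F : Tp 2) (c m n : nat) :
  ~ leaf c -> tag c <> 7 -> Converges F (child c 0 0) m ->
  (forall x, Converges F (child c (S x) m) n) -> Converges F c n.
Proof.
  intros Hc Ht H0 HS. pose (g := fun x => match x with 0 => m | S _ => n end).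
  replace n with (combine F c g) by (unfold combine; now rewrite ite_false).
  apply conv_node; [exact Hc|]. intros [|x]; [|apply HS].
  now rewrite (child_0 c _ 0).
Qed.

Lemma item_obj_num (F : Tp 2) (a : item) (x : nat) : ob 0 x = item_obj F a -> a = it_num x.
Proof.
  destruct a as [| |y]; intros H;
    [apply (f_equal (@projT1 _ _)) in H; discriminate H..|].
  apply (f_equal (fun o : obj => match o with existT _ 0 z => z | _ => 0 end)) in H.
  simpl in H. congruence.
Qed.

Lemma item_obj_high (F : Tp 2) (a : item) (k : nat) (Psi : Tp (S (S k))) :
  ob (S (S k)) Psi = item_obj F a ->
  exists E : k = 0, (a = it_F /\ eq_rect k (fun k => Tp (S (S k))) Psi 0 E = F) \/
                    (a = it_mu /\ eq_rect k (fun k => Tp (S (S k))) Psi 0 E = mu).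
Proof.
  intros H. assert (E : S (S k) = projT1 (item_obj F a)) by now rewrite <- H.
  destruct a as [| |y]; simpl in E; try discriminate E; injection E as ->;
    exists eq_refl; apply (inj_pair2_eq_dec _ Nat.eq_dec) in H; auto.
Qed.

Lemma head_config (e : nat) (a : item) (L : list item) :
  head (config e (a :: L)) = item_code a.
Proof. unfold head, args, config. rewrite right_of_pair. apply (left_of_pair (item_code a)). Qed.

Lemma tail_config (e : nat) (a : item) (L : list item) :
  tail (config e (a :: L)) = list_code L.
Proof. unfold tail, args, config. rewrite right_of_pair. apply (right_of_pair (item_code a)). Qed.

Lemma args_config (e : nat) (L : list item) : args (config e L) = list_code L.
Proof. apply right_of_pair. Qed.

Lemma index_config (e : nat) (L : list item) : index (config e L) = e.
Proof. apply left_of_pair. Qed.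

Ltac ite_simpl :=
  repeat first [rewrite ite_true by lia | rewrite ite_false by lia].

(** Induction on the computation; the arguments remain items because each scheme adds only numbers
    to them. *)
Lemma Comp_converges (F : Tp 2) (e : nat) (As : list obj) (n : nat) :
  Comp e As n ->
  forall L, As = map (item_obj F) L -> Converges F (config e L) n.
Proof.
  intros H.
  induction H as
    [ e x As He | e q As He | e x As He | e e1 e2 As m n He _ IH2 _ IH1
    | e e1 e2 As n He _ IH1 | e e1 e2 k As m n He _ IH1 _ IH2
    | e i e1 As n He Hi _ IH | e f x As He | e e1 k Psi g As He _ IH
    | e a As n He _ IH ]; intros L HL; pose proof (decode_tag e L) as T; rewrite He in T.
  - destruct L as [|a L]; [discriminate|]. injection HL as Ha HL.
    apply item_obj_num in Ha as ->. destruct T as (Hl & T1 & T2).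
    replace (S x) with (leaf_value (config e (it_num x :: L))); [now constructor|].
    unfold leaf_value. ite_simpl. rewrite head_config. simpl. lia.
  - destruct T as [T1 <-].
    replace (param (config e L)) with (leaf_value (config e L)).
    + constructor. unfold leaf. lia.
    + unfold leaf_value. now ite_simpl.
  - destruct L as [|a L]; [discriminate|]. injection HL as Ha HL.
    apply item_obj_num in Ha as ->.
    replace x with (leaf_value (config e (it_num x :: L))) at 2.
    + constructor. unfold leaf. lia.
    + unfold leaf_value. ite_simpl. rewrite head_config. simpl. lia.
  - destruct T as [T1 T2].
    apply converges_seq with (m := m); [unfold leaf; lia|lia| |].
    + unfold child. ite_simpl. rewrite T2, right_of_pair, args_config. now apply IH2.
    + intros x. unfold child. ite_simpl. rewrite T2, left_of_pair, args_config.
      apply (IH1 (it_num m :: L)). simpl. now f_equal.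
  - destruct L as [|a L]; [discriminate|]. injection HL as Ha HL.
    apply item_obj_num in Ha as ->. destruct T as [T1 T2].
    assert (E : forall x w, child (config e (it_num 0 :: L)) x w = config e1 L).
    { intros x w. unfold child.
      rewrite ite_false, ite_true by lia.
      rewrite ite_true by now rewrite head_config.
      now rewrite T2, left_of_pair, tail_config. }
    apply converges_seq with (m := n); [unfold leaf; lia|lia| |];
      intros; rewrite E; now apply IH1.
  - destruct L as [|a L]; [discriminate|]. injection HL as Ha HL.
    apply item_obj_num in Ha as ->. destruct T as [T1 T2].
    apply converges_seq with (m := m); [unfold leaf; lia|lia| |].
    + unfold child. rewrite head_config. simpl item_code. ite_simpl.
      rewrite index_config, tail_config. apply (IH1 (it_num k :: L)).
      simpl. now f_equal.
    + intros x. unfold child. rewrite head_config. simpl item_code. ite_simpl.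
      rewrite T2, right_of_pair, tail_config.
      apply (IH2 (it_num m :: it_num k :: L)). simpl. now rewrite HL.
  - destruct T as [T1 T2].
    assert (EL : exists A x y B, length A = i /\ L = A ++ x :: y :: B).
    { rewrite HL, length_map in Hi.
      exists (firstn i L). pose proof (firstn_skipn i L) as E.
      pose proof (length_skipn i L) as E'.
      destruct (skipn i L) as [|x [|y B]]; simpl in E'; try lia.
      exists x, y, B. split; [rewrite length_firstn; lia|now symmetry]. }
    destruct EL as (A & x & y & B & HA & EL).
    assert (E : forall u w, child (config e L) u w = config e1 (A ++ y :: x :: B)).
    { intros u w. unfold child. ite_simpl.
      rewrite T2, right_of_pair, left_of_pair, args_config, EL, <- HA.
      now rewrite swap_code_list_code. }
    assert (HC : Converges F (config e1 (A ++ y :: x :: B)) n).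
    { apply IH. rewrite HL, EL, !map_app. simpl.
      rewrite <- HA, <- (length_map (item_obj F) A). apply swap_at_app. }
    apply converges_seq with (m := n); [unfold leaf; lia|lia| |];
      intros; rewrite E; exact HC.
  (* S7 needs an argument of type 1, and no item has that type. *)
  - destruct L as [|a L]; [discriminate|]. injection HL as Ha HL.
    apply (f_equal (@projT1 _ _)) in Ha. destruct a; discriminate Ha.
  - destruct L as [|a L]; [discriminate|]. injection HL as Ha HL.
    destruct T as [T1 T2].
    destruct (item_obj_high F a k Psi Ha) as [E EP]. subst k. simpl in EP.
    replace (Psi g) with (combine F (config e (a :: L)) g).
    + apply conv_node; [unfold leaf; lia|]. intros x.
      unfold child. ite_simpl. rewrite T2, args_config.
      apply (IH x (it_num x :: a :: L)). simpl. now rewrite <- Ha, HL.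
    + unfold combine. rewrite ite_true by exact T1. rewrite head_config.
      destruct EP as [[-> ->]|[-> ->]]; simpl; now ite_simpl.
  - destruct L as [|b L]; [discriminate|]. injection HL as Ha HL.
    apply item_obj_num in Ha as ->.
    assert (E : forall x w, child (config e (it_num a :: L)) x w = config a L).
    { intros x w. unfold child. rewrite head_config. simpl item_code. ite_simpl.
      rewrite tail_config. unfold config. f_equal. lia. }
    apply converges_seq with (m := n); [unfold leaf; lia|lia| |];
      intros; rewrite E; now apply IH.
Qed.

(** * Guesses and the covering of Cantor space *)

(** A nonzero [f (cpair c m)] is the guess that [c] has value [m]. The least such [m] is taken, and
    [0] if there is none. *)
Definition guess_value (f : Tp 1) (c : nat) : nat :=
  least (fun m => f (cpair c m) <> 0).

Definition guess_child (f : Tp 1) (c x : nat) : nat :=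
  child c x (guess_value f (child c 0 0)).

Definition guess_eval (F : Tp 2) (f : Tp 1) (c : nat) : nat :=
  ite (leaf c) (leaf_value c)
    (combine F c (fun x => guess_value f (guess_child f c x))).

Definition locally_correct (F : Tp 2) (f : Tp 1) (c : nat) : Prop :=
  guess_value f c = guess_eval F f c.

Definition step (f : Tp 1) (c x : nat) : nat := ite (leaf c) c (guess_child f c x).

(* The number [p] codes a sequence of children to be followed for [n] steps. *)
Definition follow (f : Tp 1) (c p n : nat) : nat :=
  nat_rec (fun _ => nat) c (fun i acc => step f acc (entry p i)) n.

(** Finite paths are coded by numbers, so only numerical quantifiers occur and [mu] can decide the
    predicate. *)
Definition correct_below (F : Tp 2) (f : Tp 1) (c : nat) : Prop :=
  forall p n, locally_correct F f (follow f c p n).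

Definition next (F : Tp 2) (f : Tp 1) (c : nat) : nat :=
  step f c (least (fun x => ~ correct_below F f (step f c x))).

(** Here the descent stops: no child is inconsistent, so any inconsistency left is at the node
    itself. *)
Definition final (F : Tp 2) (f : Tp 1) (c : nat) : Prop :=
  leaf c \/ forall x, correct_below F f (step f c x).

Definition last_index (n i : nat) : nat :=
  nat_rec (fun _ => nat) 0 (fun j acc => ite (left_of (S j) = n) (S j) acc) i.

Definition first_error (F : Tp 2) (f : Tp 1) (c : nat) : nat :=
  Nat.iter (least (fun k => final F f (Nat.iter k (next F f) c))) (next F f) c.

(** On an inconsistent guess the value exceeds two codes at the first error. If [f] agrees with the
    true graph at the pair with the evaluated value, some value is guessed and [guess_value] is no
    default; agreement at the guessed pair then puts a wrong value into the graph. *)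
Definition cover (F : Tp 2) (c i : nat) : Tp 2 := fun f =>
  ite (correct_below F f c) (last_index (guess_value f c) i)
    (S (cpair (first_error F f c) (guess_value f (first_error F f c)) +
        cpair (first_error F f c) (guess_eval F f (first_error F f c)))).

Definition answer (F : Tp 2) (M : Tp 3) (c : nat) : nat :=
  left_of (S (least (fun i => M (cover F c i) <> M (cover F c (S i))))).

Lemma follow_S (f : Tp 1) (c p n : nat) :
  follow f c p (S n) = follow f (step f c (entry p 0)) (right_of p) n.
Proof.
  induction n as [|n IH]; [reflexivity|].
  change (follow f c p (S (S n))) with (step f (follow f c p (S n)) (entry p (S n))).
  now rewrite IH, entry_S.
Qed.

Section Guess.
Variables (F : Tp 2) (f : Tp 1).

Lemma correct_below_locally (c : nat) : correct_below F f c -> locally_correct F f c.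
Proof. intros H. exact (H 0 0). Qed.

Lemma correct_below_step (c x : nat) :
  correct_below F f c -> correct_below F f (step f c x).
Proof.
  intros H p n. specialize (H (cpair x p) (S n)).
  now rewrite follow_S, entry_0, right_of_pair in H.
Qed.

Lemma correct_below_node (c : nat) :
  locally_correct F f c -> (forall x, correct_below F f (step f c x)) ->
  correct_below F f c.
Proof.
  intros H0 HS p [|n]; [exact H0|]. rewrite follow_S. apply HS.
Qed.

Lemma correct_below_leaf (c : nat) :
  leaf c -> locally_correct F f c -> correct_below F f c.
Proof.
  intros Hc H p n. replace (follow f c p n) with c; [exact H|].
  induction n as [|n IH]; [reflexivity|]. simpl. fold (follow f c p n). rewrite <- IH.
  unfold step. now rewrite ite_true.
Qed.

(** Induction along the true computation. Child [0] comes first: only once its guessed value is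
    right are the other guessed children the true ones. *)
Lemma correct_value (c n : nat) :
  Converges F c n -> correct_below F f c -> guess_value f c = n.
Proof.
  intros H. induction H as [c Hc|c g Hc _ IH]; intros HC;
    rewrite (correct_below_locally c HC); unfold guess_eval.
  - now apply ite_true.
  - rewrite ite_false by exact Hc. f_equal. apply functional_extensionality. intros x.
    assert (Hs : forall x, correct_below F f (guess_child f c x)).
    { intros y. pose proof (correct_below_step c y HC) as Hy.
      unfold step in Hy. now rewrite ite_false in Hy. }
    assert (E : guess_value f (child c 0 0) = g 0).
    { rewrite (child_0 c 0 (g 0)). apply IH.
      rewrite (child_0 c (g 0) (guess_value f (child c 0 0))). apply (Hs 0). }
    specialize (Hs x). unfold guess_child in Hs |- *. rewrite E in Hs |- *. now apply IH.
Qed.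

(** The guess may be wrong at [c], but evaluation there consults only the children, whose values are
    right by [correct_value]. *)
Lemma final_eval (c n : nat) :
  Converges F c n -> final F f c -> guess_eval F f c = n.
Proof.
  unfold guess_eval. intros H [Hl|Hs].
  - rewrite ite_true by exact Hl. destruct H; [reflexivity|contradiction].
  - destruct H as [c Hc|c g Hc H]; [now apply ite_true|].
    rewrite ite_false by exact Hc. f_equal. apply functional_extensionality. intros x.
    assert (Hs' : forall x, correct_below F f (guess_child f c x)).
    { intros y. specialize (Hs y). unfold step in Hs. now rewrite ite_false in Hs. }
    assert (E : guess_value f (child c 0 0) = g 0).
    { rewrite (child_0 c 0 (g 0)). apply correct_value; [apply H|].
      rewrite (child_0 c (g 0) (guess_value f (child c 0 0))). apply (Hs' 0). }
    apply correct_value; [|apply Hs']. unfold guess_child. rewrite E. apply H.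
Qed.

Lemma final_incorrect (c : nat) :
  final F f c -> ~ correct_below F f c -> ~ locally_correct F f c.
Proof.
  intros [Hl|Hs] HC H; apply HC.
  - now apply correct_below_leaf.
  - now apply correct_below_node.
Qed.

Lemma not_final_next (c : nat) : ~ final F f c ->
  exists x, next F f c = guess_child f c x /\
    ~ correct_below F f (guess_child f c x) /\
    forall y, y < x -> correct_below F f (guess_child f c y).
Proof.
  intros H. exists (least (fun x => ~ correct_below F f (step f c x))).
  assert (Hc : ~ leaf c) by (intros Hc; apply H; now left).
  assert (E : forall x, step f c x = guess_child f c x)
    by (intros x; unfold step; now rewrite ite_false).
  rewrite <- E.
  destruct (least_spec (fun x => ~ correct_below F f (step f c x))) as [H1 H2].
  { apply not_all_ex_not. intros Hs. apply H. now right. }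
  repeat split; [exact H1|]. intros y Hy. rewrite <- E.
  apply NNPP. exact (H2 y Hy).
Qed.

(* The children to the left of the first incorrect one have correct values, so that
   child is a genuine subcomputation and the descent follows a well-founded tree. *)
Lemma first_error_spec (c n : nat) :
  Converges F c n -> ~ correct_below F f c ->
  exists m, Converges F (first_error F f c) m /\
    guess_eval F f (first_error F f c) = m /\
    guess_value f (first_error F f c) <> m.
Proof.
  intros H HC.
  enough (D : exists k, final F f (Nat.iter k (next F f) c) /\
    (forall i, i < k -> ~ final F f (Nat.iter i (next F f) c)) /\
    ~ correct_below F f (Nat.iter k (next F f) c) /\
    exists m, Converges F (Nat.iter k (next F f) c) m).
  { destruct D as (k & H1 & H2 & H3 & m & H4).
    unfold first_error. rewrite (least_eq _ k H1 H2). exists m.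
    pose proof (final_eval _ _ H4 H1) as E. repeat split; [exact H4|exact E|].
    rewrite <- E. exact (final_incorrect _ H1 H3). }
  assert (H' := H). revert H HC.
  induction H' as [c Hc|c g Hc Hg IH]; intros H HC.
  - exists 0. repeat split; [now left|lia|exact HC|now exists (leaf_value c)].
  - destruct (classic (final F f c)) as [Hf|Hf].
    { exists 0. repeat split; [exact Hf|lia|exact HC|now exists (combine F c g)]. }
    destruct (not_final_next c Hf) as (x & Ex & Hx & Hy).
    assert (E : guess_child f c x = child c x (g 0)).
    { unfold guess_child. destruct x as [|x]; [apply child_0|].
      f_equal. rewrite (child_0 c 0 (g 0)). apply correct_value; [apply Hg|].
      rewrite (child_0 c (g 0) (guess_value f (child c 0 0))). apply Hy. lia. }
    rewrite E in Ex, Hx.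
    destruct (IH x (Hg x) Hx) as (k & H1 & H2 & H3 & H4).
    rewrite <- Ex, <- Nat.iter_succ_r in H1, H3, H4.
    exists (S k). repeat split; [exact H1| |exact H3|exact H4].
    intros [|i] Hi; [exact Hf|]. rewrite Nat.iter_succ_r, Ex. apply H2. lia.
Qed.

End Guess.

(** * Reading the value off the Pincherle realiser *)

Lemma last_index_last (n y i : nat) : y <= i -> left_of y = n -> y <= last_index n i.
Proof.
  induction i as [|i IH]; intros Hy E; [lia|].
  simpl. fold (last_index n i). destruct (Nat.eq_dec y (S i)) as [->|Hne].
  - now rewrite ite_true.
  - unfold ite. destruct (excluded_middle_informative _); [lia|]. apply IH; [lia|exact E].
Qed.

Lemma last_index_skip (n i : nat) :
  left_of (S i) <> n -> last_index n (S i) = last_index n i.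
Proof. intros H. simpl. now rewrite ite_false. Qed.

(** [K] carries the bound at the true graph and vanishes elsewhere. [LOC] holds because a consistent
    [f] guesses [n], while the neighbourhood of an inconsistent [f] misses the graph. *)
Lemma cover_bound (F : Tp 2) (M : Tp 3) (c n i : nat) :
  Pincherle_realiser M -> Converges F c n -> last_index n i <= M (cover F c i).
Proof.
  intros HM Hc.
  set (graph := fun p => ite (Converges F (left_of p) (right_of p)) 1 0).
  assert (graph_1 : forall d m, Converges F d m -> graph (cpair d m) = 1).
  { intros d m H. unfold graph. apply ite_true. now rewrite left_of_pair, right_of_pair. }
  assert (graph_conv : forall d m, graph (cpair d m) <> 0 -> Converges F d m).
  { intros d m H. apply NNPP. intros H'. apply H. unfold graph. apply ite_false.
    now rewrite left_of_pair, right_of_pair. }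
  set (K := fun h : nat -> nat => ite (h = graph) (last_index n i) 0).
  assert (L : LOC K (cover F c i)).
  { intros f h _ _ Hext. unfold K. destruct (classic (h = graph)) as [->|E];
      [|rewrite ite_false by exact E; lia].
    rewrite ite_true by reflexivity.
    destruct (classic (correct_below F f c)) as [HC|HC].
    - unfold cover. rewrite ite_true, (correct_value F f c n Hc HC) by exact HC. lia.
    - exfalso. unfold cover in Hext. rewrite ite_false in Hext by exact HC.
      destruct (first_error_spec F f c n Hc HC) as (m & H1 & H2 & H3).
      rewrite H2 in Hext. set (d := first_error F f c) in *.
      apply H3. apply (converges_functional F d); [|exact H1].
      apply graph_conv. rewrite Hext by lia.
      apply (least_spec (fun m => f (cpair d m) <> 0)). exists m.
      rewrite <- (Hext (cpair d m)), graph_1 by (lia || exact H1). discriminate. }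
  specialize (HM K (cover F c i) L graph).
  replace (K graph) with (last_index n i) in HM by (unfold K; now rewrite ite_true).
  apply HM. intros p. unfold graph, ite.
  destruct (excluded_middle_informative _); lia.
Qed.

Lemma cover_stationary (F : Tp 2) (c n i : nat) :
  Converges F c n -> left_of (S i) <> n -> cover F c (S i) = cover F c i.
Proof.
  intros Hc Hi. apply functional_extensionality. intros f. unfold cover.
  destruct (classic (correct_below F f c)) as [HC|HC].
  - rewrite !(ite_true _ _ _ HC), (correct_value F f c n Hc HC).
    now apply last_index_skip.
  - now rewrite !(ite_false _ _ _ HC).
Qed.

Lemma answer_correct (F : Tp 2) (M : Tp 3) (c n : nat) :
  Pincherle_realiser M -> Converges F c n -> answer F M c = n.
Proof.
  intros HM Hc. unfold answer.
  destruct (least_spec (fun i => M (cover F c i) <> M (cover F c (S i)))) as [H _].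
  - apply not_all_ex_not. intros H.
    assert (E : forall i, M (cover F c i) = M (cover F c 0)).
    { induction i as [|i IH]; [reflexivity|]. rewrite <- IH. symmetry.
      apply H. }
    set (b := M (cover F c 0)) in E.
    (* This index has first component [n] and exceeds the supposed constant value [b]. *)
    pose proof (cover_bound F M c n (cpair n (S b)) HM Hc) as B.
    rewrite E in B.
    pose proof (last_index_last n (cpair n (S b)) _ (le_n _) (left_of_pair _ _)) as B'.
    pose proof (to_nat_non_decreasing n (S b)). unfold cpair in *. lia.
  - apply NNPP. intros Hne. apply H. now rewrite (cover_stationary F c n _ Hc Hne).
Qed.

(** * Definability of the answer *)

Ltac def_config :=
  lazymatch goal with
  | |- Definable _ _ (fun _ _ _ _ => swap_code _ _) => apply def_swap_code
  | |- Definable _ _ (fun _ _ _ _ => entry _ _) => apply def_entry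
  | |- Definable _ _ (fun _ _ _ _ => leaf_value _) => unfold leaf_value
  | |- Definable _ _ (fun _ _ _ _ => chi (leaf _)) => unfold leaf
  | |- Definable _ _ (fun _ _ _ _ => tag _) => unfold tag
  | |- Definable _ _ (fun _ _ _ _ => index _) => unfold index
  | |- Definable _ _ (fun _ _ _ _ => param _) => unfold param
  | |- Definable _ _ (fun _ _ _ _ => head _) => unfold head
  | |- Definable _ _ (fun _ _ _ _ => tail _) => unfold tail
  | |- Definable _ _ (fun _ _ _ _ => args _) => unfold args
  | |- _ => def_lists
  end.

Lemma def_child (j k : nat) (c x w : functional) :
  Definable j k c -> Definable j k x -> Definable j k w ->
  Definable j k (fun F M fs l => child (c F M fs l) (x F M fs l) (w F M fs l)).
Proof. intros. unfold child. repeat (cbv beta zeta; def_config). Qed.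

Definition guess (fs : list (Tp 1)) : Tp 1 := hd (fun _ => 0) fs.

Lemma def_guess_value (j k : nat) (c : functional) :
  Definable (S j) k c ->
  Definable (S j) k (fun F M fs l => guess_value (guess fs) (c F M fs l)).
Proof. intros. unfold guess_value, guess. repeat (cbv beta; def_config). Qed.

Lemma def_guess_child (j k : nat) (c x : functional) :
  Definable (S j) k c -> Definable (S j) k x ->
  Definable (S j) k (fun F M fs l => guess_child (guess fs) (c F M fs l) (x F M fs l)).
Proof.
  intros. apply def_child; [assumption..|].
  apply def_guess_value, def_child; [assumption|apply def_const..].
Qed.

Lemma def_guess_eval (j k : nat) (c : functional) :
  Definable (S j) k c ->
  Definable (S j) k (fun F M fs l => guess_eval F (guess fs) (c F M fs l)).
Proof.
  intros H. unfold guess_eval, combine.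
  apply def_ite; [repeat (cbv beta; def_config)..|].
  apply def_ite; [repeat (cbv beta; def_config)| |].
  - apply def_ite; [repeat (cbv beta; def_config)|apply def_F|apply def_mu];
      apply def_guess_value, def_guess_child; def_lookup.
  - apply def_guess_value, def_guess_child; [assumption|apply def_const].
Qed.

Lemma def_step (j k : nat) (c x : functional) :
  Definable (S j) k c -> Definable (S j) k x ->
  Definable (S j) k (fun F M fs l => step (guess fs) (c F M fs l) (x F M fs l)).
Proof.
  intros. unfold step. apply def_ite; [repeat (cbv beta; def_config)|assumption|].
  now apply def_guess_child.
Qed.

Lemma def_correct_below (j k : nat) (c : functional) :
  Definable (S j) k c ->
  Definable (S j) k (fun F M fs l => chi (correct_below F (guess fs) (c F M fs l))).
Proof.
  intros H. unfold correct_below, locally_correct.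
  apply def_chi_all, def_chi_all.
  assert (Hf : Definable (S j) (S (S k)) (fun F M fs l =>
    follow (guess fs) (c F M fs (tl (tl l))) (hd 0 (tl l)) (hd 0 l))).
  { unfold follow. apply def_rec; [def_lookup..|].
    apply def_step; [def_lookup|]. apply def_entry; def_lookup. }
  apply def_chi_eq; [now apply def_guess_value|now apply def_guess_eval].
Qed.

Lemma def_next (j k : nat) (c : functional) :
  Definable (S j) k c ->
  Definable (S j) k (fun F M fs l => next F (guess fs) (c F M fs l)).
Proof.
  intros. unfold next. apply def_step; [assumption|].
  apply def_least, def_chi_not, def_correct_below, def_step; def_lookup.
Qed.

Lemma def_first_error (j k : nat) (c : functional) :
  Definable (S j) k c ->
  Definable (S j) k (fun F M fs l => first_error F (guess fs) (c F M fs l)).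
Proof.
  intros H. unfold first_error.
  apply (def_iter (S j) k _ c (fun F M fs x _ => next F (guess fs) x)).
  - apply def_least. unfold final.
    assert (Hi : Definable (S j) (S k) (fun F M fs l =>
      Nat.iter (hd 0 l) (next F (guess fs)) (c F M fs (tl l)))).
    { apply (def_iter (S j) (S k) (fun _ _ _ l => hd 0 l)
        (fun F M fs l => c F M fs (tl l)) (fun F M fs x _ => next F (guess fs) x));
        [def_lookup..|]. apply def_next. def_lookup. }
    apply def_chi_or; [repeat first [exact Hi | cbv beta; def_config]|].
    apply def_chi_all, def_correct_below, def_step; def_lookup.
  - assumption.
  - apply def_next. def_lookup.
Qed.

Lemma def_cover (j k c : nat) (i : functional) :
  Definable (S j) k i ->
  Definable (S j) k (fun F M fs l => cover F c (i F M fs l) (guess fs)).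
Proof.
  intros H. unfold cover. pose proof (def_const (S j) k c) as Hc.
  pose proof (def_guess_value j k _ Hc) as Hv.
  pose proof (def_first_error j k _ Hc) as He.
  apply def_ite; [now apply (def_correct_below j k (fun _ _ _ _ => c))| |].
  - unfold last_index. apply def_rec; [assumption|apply def_const|].
    apply def_ite; [apply def_chi_eq; [apply def_left_of|]|..]; try apply def_succ; def_lookup.
  - apply def_succ, def_add; apply def_pair; try assumption;
      [now apply def_guess_value|now apply def_guess_eval].
Qed.

Lemma def_answer (c : nat) : Definable 0 0 (fun F M _ _ => answer F M c).
Proof.
  unfold answer. apply def_left_of, def_succ.
  apply (def_least 0 0 (fun F M _ i _ => M (cover F c i) <> M (cover F c (S i)))).
  apply def_chi_not, def_chi_eq.
  - apply (def_M 0 1 (fun F M f _ l => cover F c (hd 0 l) f)).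
    apply def_cover. def_lookup.
  - apply (def_M 0 1 (fun F M f _ l => cover F c (S (hd 0 l)) f)).
    apply (def_cover 0 1 c (fun _ _ _ l => S (hd 0 l))).
    apply def_succ. def_lookup.
Qed.

(* For every index e0 (Phi(F) = {e0}(F, mu)) there is a single primitive
   recursive index d (uniform in M) such that for every Pincherle realiser M,
   Psi(F) := {d}(F, M, mu) is total and extends Phi. *)
Theorem theorem3p3 :
  forall e0 : nat,
  exists d : nat, prim d /\
    forall M : Tp 3, Pincherle_realiser M ->
      forall F : Tp 2,
        (exists n, Comp d [ob 2 F; ob 3 M; ob 2 mu] n) /\
        (forall n, Comp e0 [ob 2 F; ob 2 mu] n ->
                   Comp d [ob 2 F; ob 3 M; ob 2 mu] n).
Proof.
  intros e0.
  (* The starting configuration is a fixed number, so [d] depends on [e0] only. *)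
  destruct (def_answer (config e0 [it_F; it_mu])) as (d & Hd & H).
  exists d. split; [exact Hd|]. intros M HM F.
  specialize (H F M [] [] [] eq_refl eq_refl).
  (* [answer] has a value for every [F], since [least] falls back on [0] when the values of [M]
     never change. *)
  split; [now exists (answer F M (config e0 [it_F; it_mu]))|].
  intros n Hn. rewrite <- (answer_correct F M (config e0 [it_F; it_mu]) n HM).
  - exact H.
  - now apply (Comp_converges F e0 [ob 2 F; ob 2 mu]).
Qed.
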